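(* Let $f_t(z)=z^2+t\in\mathbb{Q}(t)[z]$, and let $P_t\in\mathbb{Z}[t]$ be a monic polynomial. Then there exists a power series $F(z)\in\mathbb{Q}[[z]]$, convergent in a real neighbourhood of $0$ and satisfying $F(0)=0$, such that for all $t\in\mathbb{Q}$ with $|t|$ sufficiently large, \[\hat h_{f_t}(P_t)=\hat h_f(P)h(t)+F\!\left(\tfrac1t\right).\]
   Context: $h$ is the usual absolute logarithmic Weil height on $\mathbb{P}^1(\mathbb{Q})$. For $t\in\mathbb{Q}$, $\hat h_{f_t}(x)=\lim_{N\to\infty}2^{-N}h(f_t^N(x))$ is the canonical height of the specialized polynomial. Viewing $f\in K[z]$ and $P\in K$ with $K=\mathbb{Q}(t)$ the function field of $\mathbb{P}^1$, $\hat h_f(P)=\sum_{\beta\in\mathbb{P}^1(\overline{\mathbb{Q}})}\lim_{N\to\infty}2^{-N}\max\{0,-\operatorname{ord}_\beta(f^N(P))\}$. *)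

(* Defs.v *)
From HB Require Import structures.
From mathcomp Require Import all_boot all_order all_algebra all_field.
From mathcomp Require Import all_classical all_reals all_analysis.
Set Implicit Arguments. Unset Strict Implicit. Unset Printing Implicit Defensive.
Import Order.TTheory GRing.Theory Num.Theory numFieldNormedType.Exports.
Local Open Scope ring_scope.

Definition weil_height (R : realType) (x : rat) : R :=
  ln (Num.max (`|numq x|%:~R) ((denq x)%:~R)).

Definition f_spec (t : rat) (x : rat) : rat := x ^+ 2 + t.

Definition canon_height_spec (R : realType) (t x : rat) : R :=
  limn (fun N : nat => weil_height R (iter N (f_spec t) x) / 2 ^+ N).

(* The generic map f(z) = z^2 + t over K = Q(t).  The orbit of an element of
   Q[t] stays in Q[t], so we iterate on {poly rat} (variable 'X = t). *)
Definition f_gen (q : {poly rat}) : {poly rat} := q ^+ 2 + 'X.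

(* Points of P^1(Qbar): Some b = b in Qbar (algC), None = infinity. *)
Definition ord_P1 (beta : option algC) (q : {poly rat}) : int :=
  match beta with
  | Some b => (mup b (map_poly ratr q : {poly algC}))%:Z
  | None => - ((size q).-1)%:Z
  end.

(* max{0, - ord_beta(q)}; for q = 0 the order is +oo, so this is 0. *)
Definition neg_ord (beta : option algC) (q : {poly rat}) : int :=
  if q == 0 then 0 else Num.max 0 (- ord_P1 beta q).

Definition canon_height_gen (R : realType) (P : {poly rat}) : \bar R :=
  \esum_(beta in [set: option algC])
     (limn (fun N : nat => (neg_ord beta (iter N f_gen P))%:~R / 2 ^+ N : R))%:E.

Definition pseries_sum (R : realType) (a : nat -> rat) (z : R) : R :=
  limn (series (fun n => ratr (a n) * z ^+ n)).

(* Main.v *)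
(* For monic P of degree d >= 1 put P_N = f^N(P), monic in Z[t] of degree
   d 2^N.  If t = n/b in lowest terms, then P_N(t) has denominator b^(d 2^N), so
     h(P_N(t)) = d 2^N h(t) + ln |Q_N(1/t)|  for large |t|,
   where Q_N(z) = z^(d 2^N) P_N(1/z) has constant term 1 and
   Q_(N+1) = Q_N^2 + z^(d 2^(N+1) - 1).  Hence the formal series 2^-N log Q_N
   stabilise coefficientwise to a rational series F.  The complex roots of P_N
   stay in a fixed disc (large t escape), so those of Q_N avoid a disc of radius
   rho independent of N.  Summing 1/(z - beta) over the d 2^N roots beta of Q_N
   bounds the n-th Taylor remainder of 2^-N log Q_N at z by a constant times
   (|z|/rho)^n, uniformly in N; therefore 2^-N ln |Q_N(z)| --> F(z).
   If P = 1, apply this to f(P) = t + 1 and halve. *)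
Require Import Defs.
From HB Require Import structures.
From mathcomp Require Import all_boot all_order all_algebra all_field.
From mathcomp Require Import all_classical all_reals all_analysis.
From mathcomp Require Import complex ring lra zify.
Set Implicit Arguments. Unset Strict Implicit. Unset Printing Implicit Defensive.
Import Order.TTheory GRing.Theory Num.Theory numFieldNormedType.Exports.
Local Open Scope classical_set_scope.
Local Open Scope ring_scope.

(** * Logarithmic derivatives of polynomials modulo powers of ['X] *)

Section LogDerivative.
Variable F : fieldType.
Implicit Types Q S : {poly F}.

Lemma coef_dvdXn n (p : {poly F}) k : 'X^n %| p -> (k < n)%N -> p`_k = 0.
Proof. by move=> /dvdpP[q ->] kn; rewrite coefMXn kn. Qed.

Lemma dvdXn_coef n (p : {poly F}) :
  (forall k, (k < n)%N -> p`_k = 0) -> 'X^n %| p.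
Proof.
move=> pn0; apply/dvdpP; exists (drop_poly n p).
rewrite -[LHS](poly_take_drop n) (_ : take_poly n p = 0) ?add0r //.
by apply/polyP => k; rewrite coef_take_poly coef0; case: ifP => // /pn0.
Qed.

(* [S] is [Q' / Q] up to order [n]. *)
Definition log_deriv_mod n Q S : bool := 'X^n %| Q * S - Q^`().

(* Geometric expansion of [1 / Q] around [Q = 1]. *)
Definition log_deriv_trunc n Q : {poly F} :=
  Q^`() * \sum_(j < n) (1 - Q) ^+ j.

Lemma log_deriv_truncP n Q :
  Q.[0] = 1 -> log_deriv_mod n Q (log_deriv_trunc n Q).
Proof.
move=> Q0; rewrite /log_deriv_mod /log_deriv_trunc.
have := subrX1 (1 - Q) n; set s := \sum_(_ < _) _ => e.
(* The geometric sum telescopes, so the defect is exactly this product, and ['X] divides [1 - Q]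
   because [Q.[0] = 1]. *)
rewrite (_ : _ - _ = - Q^`() * (1 - Q) ^+ n); last first.
  by move: e => /(canRL (subrK _)) ->; ring.
by rewrite dvdp_mull // dvdp_exp2r // -['X]subr0 -polyC0 dvdp_XsubCl /root
  !hornerE Q0 subrr.
Qed.

(** [Q] is prime to ['X], hence can be cancelled modulo ['X^n]. *)
Lemma log_deriv_mod_uniq n Q S S' : Q.[0] = 1 ->
  log_deriv_mod n Q S -> log_deriv_mod n Q S' -> 'X^n %| S - S'.
Proof.
move=> Q0 QS QS'; rewrite -(@Gauss_dvdpr _ _ Q); last first.
  by rewrite coprimep_expl // coprimep_sym coprimepX /root Q0 oner_neq0.
rewrite (_ : Q * (S - S') = Q * S - Q^`() - (Q * S' - Q^`())); last by ring.
exact: dvdp_sub.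
Qed.

Lemma log_deriv_mod_congr n Q S S' :
  'X^n %| S - S' -> log_deriv_mod n Q S -> log_deriv_mod n Q S'.
Proof.
move=> SS' QS; rewrite /log_deriv_mod.
rewrite (_ : _ - _ = Q * S - Q^`() - Q * (S - S')); last by ring.
by apply: dvdp_sub => //; exact: dvdp_mull.
Qed.

Lemma log_deriv_mod_le m n Q S : (m <= n)%N ->
  log_deriv_mod n Q S -> log_deriv_mod m Q S.
Proof. by move=> mn; apply/dvdp_trans/dvdp_exp2l. Qed.

(** Squaring doubles the logarithmic derivative. Differentiating ['X^m] costs one order, so the
    added monomial is invisible modulo ['X^n] exactly when [n <= m - 1]. *)
Lemma log_deriv_mod_sqrDXn n m Q S : (n < m)%N ->
  log_deriv_mod n Q S -> log_deriv_mod n (Q ^+ 2 + 'X^m) (2%:R *: S).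
Proof.
case: m => // m nm QS; rewrite /log_deriv_mod derivD derivXn expr2 derivM /=.
rewrite scaler_nat -[S *+ 2]mulr_natl -['X^m *+ _]mulr_natl exprS.
rewrite (_ : _ - _ = 2%:R * Q * (Q * S - Q^`())
    + 'X^m * (2%:R * 'X * S - m.+1%:R)); last by ring.
by apply: dvdp_add; [exact: dvdp_mull | apply/dvdp_mulr/dvdp_exp2l].
Qed.

End LogDerivative.

(** * Taylor remainders of a logarithm on a disc without roots *)

Section RootBound.
Variables (K : numFieldType) (rho : K).
Hypothesis rho_gt0 : 0 < rho.

(** [S] is the truncated geometric series of [1 / (z - b)]. Its remainder is [(z / b)^n / (z - b)],
    and the triangle inequality bounds [|z - b|] below by [rho - |z|]. *)
Lemma log_deriv_linear n (b : K) : rho <= `|b| ->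
  exists S : {poly K}, [/\ (size S <= n)%N, log_deriv_mod n ('X - b%:P) S &
    forall z, `|z| < rho ->
      `|(z - b)^-1 - S.[z]| <= (`|z| / rho) ^+ n / (rho - `|z|)].
Proof.
move=> rb; have bgt0 : 0 < `|b| by exact: lt_le_trans rb.
have b0 : b != 0 by rewrite -normr_gt0.
pose x : {poly K} := b^-1 *: 'X.
pose S : {poly K} := - b^-1 *: \sum_(i < n) x ^+ i.
have xb : 'X - b%:P = b *: (x - 1).
  by rewrite scalerBr scalerA divff // scale1r alg_polyC.
have QS : ('X - b%:P) * S = 1 - x ^+ n.
  rewrite xb /S -scalerAl -scalerAr scalerA mulrN divff // scaleN1r.
  by rewrite -subrX1 opprB.
exists S; split.
- apply/(leq_trans (size_scale_leq _ _))/(leq_trans (size_sum _ _ _)).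
  apply/bigmax_leqP => i _; rewrite exprZn.
  by apply: leq_trans (size_scale_leq _ _) _; rewrite size_polyXn.
- by rewrite /log_deriv_mod QS derivXsubC addrAC subrr add0r exprZn dvdpNr
    dvdpZr ?dvdpp // expf_neq0 // invr_neq0.
move=> z zr; have zb : `|z| < `|b| by exact: lt_le_trans rb.
have zb0 : z - b != 0.
  by rewrite subr_eq0; apply: contraTneq zb => ->; rewrite ltxx.
have -> : (z - b)^-1 - S.[z] = (z / b) ^+ n / (z - b).
  have : (z - b) * S.[z] = 1 - (z / b) ^+ n.
    rewrite -[z - b]hornerXsubC -hornerM QS hornerD hornerN horner_exp.
    by rewrite hornerZ hornerX hornerC mulrC.
  by move/(canRL (mulKf zb0)) => ->; field.
rewrite normrM normfV normrX normf_div; apply: ler_pM.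
- by rewrite exprn_ge0 // divr_ge0.
- by rewrite invr_ge0.
- rewrite lerXn2r ?nnegrE ?divr_ge0 ?(ltW rho_gt0) //.
  by rewrite ler_wpM2l // lef_pV2.
- rewrite lef_pV2 ?posrE ?subr_gt0 ?normr_gt0 //.
  by rewrite (le_trans (lerB rb (lexx _))) // distrC lerB_dist.
Qed.

(** Logarithmic derivatives of factors add up, and so do their remainders. The bound is therefore
    linear in the number of roots, a growth that division by [2 ^+ N] will absorb. *)
Lemma log_deriv_prod n (bs : seq K) :
  (forall b, b \in bs -> rho <= `|b|) ->
  let Q := \prod_(b <- bs) ('X - b%:P) in
  exists S : {poly K}, [/\ (size S <= n)%N, log_deriv_mod n Q S &
    forall z, `|z| < rho -> Q.[z] != 0 /\
      `|Q^`().[z] / Q.[z] - S.[z]|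
        <= (size bs)%:R * ((`|z| / rho) ^+ n / (rho - `|z|))].
Proof.
elim: bs => [|b bs IH] bsP.
  exists 0; rewrite /log_deriv_mod big_nil -[1]/(1%:P) derivC mulr0 subr0 dvdp0
    size_poly0.
  by split=> // z _; rewrite !hornerE oner_neq0 oppr0 normr0.
case: IH => [c cbs|S [sS QS Sz]]; first by apply: bsP; rewrite inE cbs orbT.
case: (@log_deriv_linear n b) => [|T [sT QT Tz]]; first by apply: bsP; rewrite
  mem_head.
rewrite big_cons /=; set Q := \prod_(_ <- _) _ in QS Sz *.
exists (T + S); split.
- by rewrite (leq_trans (size_polyD _ _)) // geq_max sT.
- rewrite /log_deriv_mod derivM.
  rewrite (_ : _ - _ = Q * (('X - b%:P) * T - ('X - b%:P)^`())
     + ('X - b%:P) * (Q * S - Q^`())); last by ring.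
  by apply: dvdp_add; exact: dvdp_mull.
move=> z zr; have [Qz {}Sz] := Sz z zr.
have zb0 : z - b != 0.
  rewrite subr_eq0; apply: contraTneq zr => ->.
  have rb : rho <= `|b| by apply: bsP; rewrite mem_head.
  by apply/negP => /(le_lt_trans rb); rewrite ltxx.
rewrite hornerM hornerXsubC mulf_neq0 //; split=> //.
rewrite derivM derivXsubC mul1r !hornerE.
rewrite (_ : _ / _ - _ = ((z - b)^-1 - T.[z]) + (Q^`().[z] / Q.[z] - S.[z])).
  rewrite (le_trans (ler_normD _ _)) //= -addn1 natrD -mulrA mulrDl mul1r.
  by rewrite [leRHS]addrC lerD ?Tz // mulrA.
by field; rewrite Qz zb0.
Qed.

End RootBound.

(** Mean value theorem on the segment from 0 to [z], parametrised by [[0, 1]]; the difference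
    vanishes at 0. *)
Lemma ln_horner_sub_le (R : realType) (Q W : {poly R}) (M z : R) :
  Q.[0] = 1 -> W.[0] = 0 ->
  (forall x, `|x| <= `|z| -> Q.[x] != 0 /\
     `|Q^`().[x] / Q.[x] - W^`().[x]| <= M) ->
  `| ln `|Q.[z]| - W.[z] | <= M * `|z|.
Proof.
move=> Q0 W0 QW.
(* [ln (Q^2) / 2] instead of [ln `|Q|]: no sign of [Q] is needed. *)
pose g (x : R) := ln (Q.[x * z] ^+ 2) / 2 - W.[x * z].
pose g' (x : R) := (Q^`().[x * z] / Q.[x * z] - W^`().[x * z]) * z.
have xz (x : R) : x \in `[0, 1] -> `|x * z| <= `|z|.
  rewrite in_itv /= => /andP[x0 x1]; rewrite normrM ger0_norm //.
  by rewrite ler_piMl.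
have gD (x : R) : x \in `[0, 1] -> is_derive x 1 g (g' x).
  move=> /xz /QW[Qx _].
  have h1 p : is_derive x 1 (fun y => p.[y * z]) (p^`().[x * z] * z).
    pose q := p \Po (z *: 'X).
    have -> : (fun y => p.[y * z]) = horner q.
      by apply/funext => y; rewrite horner_comp !hornerE mulrC.
    have -> : p^`().[x * z] * z = q^`().[x].
      rewrite deriv_comp derivZ derivX alg_polyC hornerM hornerC.
      by rewrite horner_comp hornerZ hornerX [z * x]mulrC.
    exact: is_derive_poly.
  have Q2 : 0 < (Q ^+ 2).[x * z] by rewrite horner_exp exprn_even_gt0.
  have h2 := @is_derive1_comp R (@ln R) (fun y => (Q ^+ 2).[y * z]) x _ _
    (is_derive1_ln Q2) (h1 (Q ^+ 2)).
  have -> : g = 2^-1 *: (@ln R \o (fun y => (Q ^+ 2).[y * z]))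
                - (fun y => W.[y * z]).
    by apply/funext => y; rewrite !fctE /g /= horner_exp mulrC.
  have h3 := @is_deriveB R R R _ _ x 1 _ _ (@is_deriveZ R R R _ 2^-1 x 1 _ h2)
    (h1 W).
  apply: (is_derive_eq h3).
  rewrite /g' expr2 derivM hornerM hornerD !hornerM.
  have fieldE (q q' w : R) : q != 0 ->
      2^-1 * ((q * q)^-1 * ((q' * q + q * q') * z)) - w * z = (q' / q - w) * z.
    by move=> q0; field.
  exact: fieldE.
have g_drv : forall x : R, x \in `]0, 1[ -> is_derive x 1 g (g' x).
  by move=> x /subset_itv_oo_cc; exact: gD.
have g_cont : {within `[0, 1], continuous g}%classic.
  by apply: derivable_within_continuous => x /gD[].
have [c c01 gc] := @MVT R g g' 0 1 ltr01 g_drv g_cont.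
move: gc; rewrite /g /g' !mul0r mul1r Q0 W0 expr1n ln1 mul0r !subr0 mulr1.
rewrite -[Q.[z] ^+ 2]real_normK ?num_real // lnXn; last first.
  by rewrite normr_gt0; have [] := QW _ (lexx `|z|).
rewrite -[ln _ *+ 2]mulr_natr mulfK // => ->.
rewrite normrM ler_wpM2r //; have [|_] := QW (c * z) _; last by [].
exact/xz/subset_itv_oo_cc.
Qed.

(** The remainder of the logarithmic derivative is estimated over [R[i]], where [Q] splits, then
    brought back to [R] and integrated. *)
Lemma ln_horner_approx (R : realType) (Q W : {poly R}) (n D : nat) (rho z : R) :
  0 < rho -> Q.[0] = 1 -> (size Q <= D.+1)%N ->
  (forall b : R[i], root (map_poly (real_complex R) Q) b ->
     (rho%:C)%C <= `|b|) ->
  W.[0] = 0 -> (size W^`() <= n)%N -> log_deriv_mod n Q W^`() ->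
  `|z| < rho ->
  `|ln `|Q.[z]| - W.[z]| <= D%:R * ((`|z| / rho) ^+ n / (rho - `|z|)) * `|z|.
Proof.
move=> rho0 Q0 sQ Qroot W0 sW QW zr; apply: ln_horner_sub_le => // x xz.
set QC := map_poly (real_complex R) Q in Qroot.
have [bs QCE] := closed_field_poly_normal QC.
have Qneq0 : Q != 0 by apply: contra_eq_neq Q0 => ->; rewrite horner0 eq_sym
  oner_neq0.
set c := lead_coef QC in QCE.
have c0 : c != 0 by rewrite lead_coef_eq0 map_poly_eq0.
have bsP b : b \in bs -> (rho%:C)%C <= `|b|.
  by move=> bbs; apply: Qroot; rewrite QCE rootZ // root_prod_XsubC.
have sbs : (size bs <= D)%N.
  have := congr1 (fun p : {poly R[i]} => size p) QCE.
  by rewrite size_scale // size_prod_XsubC size_map_poly => e; move: sQ; rewrite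
    e.
have rhoC : 0 < (rho%:C)%C :> R[i] by rewrite ltcR.
have [S [sS PS Sz]] := log_deriv_prod rhoC n bsP.
set P := \prod_(b <- bs) ('X - b%:P) in PS Sz QCE.
have QS : log_deriv_mod n QC S.
  by rewrite /log_deriv_mod QCE derivZ -scalerAl -scalerBr dvdpZr.
(* Both sides agree modulo ['X^n] by uniqueness and have size at most [n], so the bound proved for
   [S] applies to the given [W]. *)
have SE : S = map_poly (real_complex R) W^`().
  apply/eqP; rewrite -subr_eq0; apply/eqP/polyP => k; rewrite coef0.
  case: (ltnP k n) => [kn|nk].
    apply: (coef_dvdXn _ kn); apply: (log_deriv_mod_uniq _ QS).
      by rewrite -[0](rmorph0 (real_complex R)) horner_map Q0 rmorph1.
    by rewrite /log_deriv_mod /QC deriv_map -rmorphM -rmorphB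
      -(map_polyXn (real_complex R)) dvdp_map.
  rewrite coefB !nth_default ?subrr // ?size_map_poly.
    exact: leq_trans nk.
  exact: leq_trans nk.
have xr : `|x| < rho by exact: le_lt_trans zr.
have normC (y : R) : `|(y%:C)%C| = (`|y|%:C)%C :> R[i].
  by rewrite normc_def /= expr0n addr0 sqrtr_sqr.
have [|Pz0] := Sz (x%:C)%C; first by rewrite normC ltcR.
have QCx : (Q.[x]%:C)%C = c * P.[(x%:C)%C] by rewrite -horner_map -/QC QCE
  hornerZ.
have QCdx : (Q^`().[x]%:C)%C = c * P^`().[(x%:C)%C].
  by rewrite -horner_map -deriv_map -/QC QCE derivZ hornerZ.
have Qx0 : Q.[x] != 0.
  by rewrite -(fmorph_eq0 (real_complex R)) /= QCx mulf_neq0.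
move=> bnd; split => //.
have {bnd} : `|Q^`().[x] / Q.[x] - W^`().[x]|
    <= (size bs)%:R * ((`|x| / rho) ^+ n / (rho - `|x|)).
  rewrite -lecR -normC rmorphB fmorph_div /= QCx QCdx -mulf_div divff // mul1r.
  rewrite -horner_map -SE (le_trans bnd) // normC.
  by rewrite !(rmorphM, rmorphXn, rmorphB, rmorph_nat, fmorphV).
(* The bound grows with the number of roots and with the modulus of the point, so [D] and [z] give
   the worst case. *)
move=> /le_trans; apply.
apply: ler_pM => //; rewrite ?ler_nat //.
  by rewrite divr_ge0 ?exprn_ge0 ?divr_ge0 ?(ltW rho0) // subr_ge0 ltW.
apply: ler_pM.
- by rewrite exprn_ge0 // divr_ge0 // ltW.
- by rewrite invr_ge0 subr_ge0 ltW.
- by rewrite lerXn2r ?nnegrE ?divr_ge0 ?(ltW rho0) // ler_wpM2r // invr_ge0 ltW.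
- by rewrite lef_pV2 ?posrE ?subr_gt0 // lerB.
Qed.

(** * The orbit of [P]: reversed polynomials and exact denominators *)

Section Orbit.
Variables (P : {poly int}) (d : nat).
Hypotheses (d_gt0 : (0 < d)%N) (P_monic : P \is monic) (size_P : size P = d.+1).

(* [rev_orbit N] is the polynomial z^(d 2^N) f^N(P)(1/z). *)
Fixpoint rev_orbit (N : nat) : {poly int} :=
  if N is M.+1 then rev_orbit M ^+ 2 + 'X^((d * 2 ^ M.+1).-1)
  else \poly_(i < d.+1) P`_(d - i).

Lemma rev_orbit0 N : (rev_orbit N).[0] = 1.
Proof.
elim: N => [|N IH] /=.
  rewrite horner_coef0 coef_poly /= subn0.
  by move: P_monic; rewrite monicE lead_coefE size_P => /eqP.
rewrite hornerD horner_exp IH expr1n hornerXn expr0n.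
by case: eqP => [e|_]; rewrite ?addr0 //; have := expn_gt0 2 N; rewrite expnS in
  e; nia.
Qed.

Lemma size_rev_orbit N : (size (rev_orbit N) <= (d * 2 ^ N).+1)%N.
Proof.
elim: N => [|N IH] /=; first by rewrite muln1 size_poly.
rewrite (leq_trans (size_polyD _ _)) // geq_max size_polyXn.
apply/andP; split; last by rewrite ltnS leq_pred.
rewrite (leq_trans (size_poly_exp_leq _ _)) // ltnS mulnC expnS mulnCA.
  by rewrite leq_mul2l /= -subn1 leq_subLR add1n.
Qed.

Lemma horner_rev_orbit (F : fieldType) (t : F) N : t != 0 ->
  iter N (fun x => x ^+ 2 + t) (map_poly intr P).[t]
  = t ^+ (d * 2 ^ N) * (map_poly intr (rev_orbit N)).[t^-1].
Proof.
move=> t0; elim: N => [|N IH] /=.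
  rewrite muln1 !(horner_coef_wide (n := d.+1)); first last.
  - by rewrite -size_P size_poly.
  - exact: leq_trans (size_poly _ _) (size_poly _ _).
  rewrite mulr_sumr (reindex_inj rev_ord_inj) /=; apply: eq_bigr => i _.
  rewrite !coef_map coef_poly ltn_ord subSS mulrCA exprVn; congr (_ * _).
  by rewrite expfB_cond // ?(negPf t0) ?add0n // -ltnS.
rewrite IH rmorphD rmorphXn /= map_polyXn hornerD horner_exp hornerXn.
have -> : (d * 2 ^ N.+1 = d * 2 ^ N * 2)%N by rewrite expnSr mulnA.
rewrite mulrDr exprMn -exprM; congr (_ + _); rewrite exprVn.
(* With [D = d * 2 ^ N], the added monomial becomes [t^(2D) * t^-(2D - 1) = t]. *)
have e : (d * 2 ^ N * 2 = (d * 2 ^ N * 2).-1.+1)%N.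
  by rewrite prednK // !muln_gt0 d_gt0 expn_gt0.
by rewrite {1}e exprS mulfK ?expf_neq0.
Qed.

(** No cancellation ever occurs: modulo [b] the numerator is [a ^+ d] at the start, since [P] is
    monic, and is squared at each step, so it stays prime to [b]. *)
Lemma orbit_frac (a b : int) N : b != 0 -> coprimez a b ->
  exists2 A : int, coprimez A b &
    iter N (fun x : rat => x ^+ 2 + a%:~R / b%:~R)
      (map_poly intr P).[a%:~R / b%:~R] = A%:~R / (b ^+ (d * 2 ^ N))%:~R.
Proof.
move=> b0 ab; have bQ0 : b%:~R != 0 :> rat by rewrite intr_eq0.
elim: N => [|N [A cA IH]] /=.
  exists (a ^+ d + b * \sum_(i < d) P`_i * a ^+ i * b ^+ (d.-1 - i)).
    rewrite coprimez_sym /coprimez addrC mulrC gcdzMDl.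
    by rewrite -/(coprimez _ _) coprimez_sym coprimezXl.
  rewrite muln1 (horner_coef_wide (n := d.+1)); last by rewrite -size_P
    size_poly.
  rewrite big_ord_recr /= coef_map /=.
  have -> : P`_d = 1 by move: P_monic; rewrite monicE lead_coefE size_P => /eqP.
  rewrite mul1r rmorphD mulrDl addrC !rmorphXn expr_div_n; congr (_ + _).
  rewrite rmorphM rmorph_sum mulr_sumr mulr_suml; apply: eq_bigr => i _.
  rewrite coef_map /= !rmorphM !rmorphXn /= expr_div_n.
  have -> : b%:~R ^+ d = b%:~R ^+ ((d.-1 - i).+1 + i) :> rat.
    by congr (_ ^+ _); have := ltn_ord i; lia.
  by rewrite exprD exprS; field; rewrite !expf_neq0 // bQ0.
(* Over the common denominator [b^(2D)], with [D = d * 2 ^ N], the term [a / b] contributes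
   [a * b^(2D - 1)]; one factor [b] is set apart to show coprimality. *)
exists (A ^+ 2 + b * (a * b ^+ (d * 2 ^ N.+1 - 2))).
  rewrite coprimez_sym /coprimez addrC mulrC gcdzMDl.
  by rewrite -/(coprimez _ _) coprimez_sym coprimezXl.
rewrite IH (_ : d * 2 ^ N.+1 = (d * 2 ^ N).-1 + (d * 2 ^ N).-1 + 2)%N; last
  first.
  by have := expn_gt0 2 N; rewrite expnS; nia.
have -> : (b ^+ (d * 2 ^ N) = b ^+ (d * 2 ^ N).-1 * b).
  by rewrite -exprSr prednK // muln_gt0 d_gt0 expn_gt0.
rewrite addnK !exprD !(rmorphM, rmorphD, rmorphXn) /=.
by field; rewrite !expf_neq0 // bQ0.
Qed.

End Orbit.

(** * Escape of the orbit for large parameters *)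

Section Escape.
Variable K : numFieldType.

(** If [|y| >= |x|] then [|y^2 + t| >= |y|^2 - 2|y| >= |y|], the last step because [|y| >= 3]. *)
Lemma norm_orbit_ge (t x : K) N : 3%:R <= `|x| -> `|t| <= 2%:R * `|x| ->
  `|x| <= `|iter N (fun y => y ^+ 2 + t) x|.
Proof.
move=> x3 tx; elim: N => //= N; set y := iter _ _ _ => xy.
have y0 : 0 <= `|y| by []. 
have y3 : 3%:R <= `|y| by exact: le_trans xy.
have : `|y| ^+ 2 - `|t| <= `|y ^+ 2 + t|.
  by rewrite -normrX lerB_normD.
apply: le_trans; apply: (le_trans xy).
rewrite lerBrDr (le_trans (lerD (lexx _) (le_trans tx (ler_wpM2l _ xy)))) //.
rewrite (_ : _ + _ = 3%:R * `|y|); last by ring.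
by rewrite expr2 ler_wpM2r.
Qed.

(** With [C] the sum of the absolute values of the lower coefficients, [2C] ensures
    [|t| - C >= |t| / 2], and 6 turns [|P(t)| >= |t| / 2] into [|P(t)| >= 3]. Being an integer, the
    radius can be read in [rat], [R] and [R[i]] alike. *)
Definition escape_radius (P : {poly int}) : int :=
  6 + 2 * \sum_(i < (size P).-1) `|P`_i|.

(** The leading term dominates: for degree [d + 1], [|P(t)| >= (|t| - C) |t|^d], where
    [|t| >= 1]. *)
Lemma norm_monic_ge (P : {poly int}) (t : K) :
  P \is monic -> (1 < size P)%N -> (escape_radius P)%:~R <= `|t| ->
  `|t| <= 2%:R * `|(map_poly intr P).[t]|.
Proof.
move=> Pm sP; rewrite /escape_radius rmorphD rmorphM rmorph_sum.
under eq_bigr => i _ do rewrite /= intr_norm.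
have Plead : P`_(size P).-1 = 1 by rewrite -lead_coefE (eqP Pm).
have [d sPd] : exists d, size P = d.+2 by exists (size P).-2; lia.
rewrite sPd /= in Plead *.
set C := \sum_(_ < _) _ => Ct.
have C0 : 0 <= C by apply: sumr_ge0.
have t1 : 1 <= `|t|.
  apply: le_trans Ct; rewrite -[leLHS]addr0 lerD // ?mulr_ge0 //.
  by rewrite ler1n.
rewrite (horner_coef_wide (n := d.+2)); last first.
  by rewrite -sPd size_poly.
rewrite big_ord_recr /= coef_map /= Plead mul1r.
set s := \sum_(_ < _) _.
have sC : `|s| <= C * `|t| ^+ d.
  rewrite mulr_suml (le_trans (ler_norm_sum _ _ _)) //.
  apply: ler_sum => i _; rewrite coef_map normrM ler_wpM2l // normrX.
  by rewrite ler_weXn2l // -ltnS.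
apply: le_trans (_ : 2%:R * (`|t| ^+ d.+1 - C * `|t| ^+ d) <= _); last first.
  rewrite ler_wpM2l // -normrX addrC (le_trans _ (lerB_normD _ _)) //.
  by rewrite lerB.
rewrite exprS -mulrBl mulrA.
apply: le_trans (_ : `|t| * 1 <= _); first by rewrite mulr1.
apply: ler_pM => //; last exact: exprn_ege1.
rewrite mulrBr lerBrDr [leRHS]mulr_natl mulr2n lerD2l.
by rewrite (le_trans _ Ct) // lerDr.
Qed.

(** Serves twice: over [R[i]] it confines the roots of the iterates to a fixed disc, and over [rat]
    it makes the numerator dominate in the height. *)
Lemma norm_escape_orbit_ge (P : {poly int}) (t : K) N :
  P \is monic -> (1 < size P)%N -> (escape_radius P)%:~R <= `|t| ->
  3%:R <= `|iter N (fun y => y ^+ 2 + t) (map_poly intr P).[t]|.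
Proof.
move=> Pm sP Pt; have tP := norm_monic_ge Pm sP Pt.
have P3 : 3%:R <= `|(map_poly intr P).[t]|.
  rewrite -(@ler_pM2l _ 2%:R) // (le_trans _ tP) // (le_trans _ Pt) //.
  rewrite -[2%:R * _]natrM -[(2 * 3)%:R]/((6 : int)%:~R) ler_int lerDl.
  by rewrite mulr_ge0 // sumr_ge0.
exact: le_trans P3 (norm_orbit_ge _ P3 tP).
Qed.

End Escape.

(** * Coefficientwise stabilisation and convergence of the limit series *)

Section LimitCoefficients.
Variables (F : numFieldType) (Q : nat -> {poly F}) (m : nat -> nat).
Hypothesis Q0 : forall N, (Q N).[0] = 1.
Hypothesis QS : forall N, Q N.+1 = Q N ^+ 2 + 'X^(m N).
Hypothesis m_gt : forall N, (N < m N)%N.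

(* The coefficient of [X^k] in [2^-N log (Q N)], the same for all [N >= k]. *)
Definition log_coef (k : nat) : F :=
  if k is j.+1 then (log_deriv_trunc k (Q k))`_j / (2 ^+ k * k%:R) else 0.

Lemma log_deriv_mod_iter n N j S : (n <= N)%N ->
  log_deriv_mod n (Q N) S -> log_deriv_mod n (Q (N + j)) (2 ^+ j *: S).
Proof.
move=> nN nS; elim: j => [|j IH]; first by rewrite addn0 expr0 scale1r.
rewrite addnS exprS -scalerA QS; apply: log_deriv_mod_sqrDXn IH.
by apply: leq_ltn_trans (m_gt _); rewrite (leq_trans nN) ?leq_addr.
Qed.

(** One polynomial, scaled by [2 ^+ N], serves every level [N >= n], because each step up merely
    doubles the low-order part of the logarithmic derivative. *)
Lemma log_deriv_mod_log_coef n N : (n <= N)%N ->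
  log_deriv_mod n (Q N) (2 ^+ N *: \poly_(k < n.+1) log_coef k)^`().
Proof.
move=> nN; apply: (log_deriv_mod_congr _ (log_deriv_truncP n (Q0 N))).
apply: dvdXn_coef => k kn; rewrite coefB derivZ coefZ coef_deriv coef_poly ltnS
  kn.
(* [log_coef j] is read off at level [j], so the coefficient of degree [k] is compared between
   levels [j] and [N], modulo ['X^j] only. *)
set j := k.+1; have jN : (j <= N)%N by exact: leq_trans nN.
have := log_deriv_mod_iter (N - j) (leqnn j) (log_deriv_truncP j (Q0 j)).
rewrite subnKC // => h1.
have h2 := log_deriv_mod_le (m := j) kn (log_deriv_truncP n (Q0 N)).
have := coef_dvdXn (log_deriv_mod_uniq (Q0 N) h2 h1) (ltnSn k).
rewrite coefB coefZ => /eqP; rewrite subr_eq0 => /eqP ->.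
apply/eqP; rewrite subr_eq0; apply/eqP.
rewrite /log_coef -/j -[_ *+ j]mulr_natr.
have -> : 2 ^+ N = 2 ^+ (N - j) * 2 ^+ j :> F by rewrite -exprD subnK.
by field; rewrite expf_neq0 ?pnatr_eq0.
Qed.

End LimitCoefficients.


(** Uniformity in [N] makes the partial sums Cauchy, since any two of them are close to a common
    [F N]; the diagonal [n = N] then gives the limit of [F]. *)
Lemma cvg_series_approx (R : realType) (u F : R^nat) (C th : R) :
  0 <= th < 1 ->
  (forall n N, (n <= N)%N -> `|F N - series u n.+1| <= C * th ^+ n) ->
  cvgn (series u) /\ F @ \oo --> limn (series u).
Proof.
move=> /andP[th0 th1] approx.
have Cth : C * th ^+ n @[n --> \oo] --> (0 : R).
  rewrite -[X in _ --> X](mulr0 C); apply: cvgMr.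
  by apply: cvg_expr; rewrite ger0_norm.
have cu : cvgn (series u).
  apply/cauchy_cvgP; apply: cauchy_exP => e e0.
  have e2 : 0 < e / 2 by rewrite divr_gt0.
  have /cvgrPdist_lt /(_ _ e2)[n _ /(_ n (leqnn n)) /= Cn] := Cth.
  exists (series u n.+1); exists n.+1 => // -[//|k] /= nk.
  rewrite /ball /= (splitr e).
  have -> : series u n.+1 - series u k.+1
      = (F (maxn n k) - series u k.+1) - (F (maxn n k) - series u n.+1) by ring.
  have Cn' : C * th ^+ n < e / 2.
    by move: Cn; rewrite sub0r normrN; exact/le_lt_trans/ler_norm.
  have C0 : 0 <= C.
    by have := approx 0%N 0%N (leqnn _); rewrite expr0 mulr1; exact: le_trans.
  have Ck : C * th ^+ k <= C * th ^+ n.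
    by rewrite ler_wpM2l // ler_wiXn2l // ltW.
  rewrite (le_lt_trans (ler_normB _ _)) // ltrD //.
    by rewrite (le_lt_trans _ (le_lt_trans Ck Cn')) // approx // leq_maxr.
  by rewrite (le_lt_trans _ Cn') // approx // leq_maxl.
split=> //; apply/cvgrPdist_lt => e e0.
have e2 : 0 < e / 2 by rewrite divr_gt0.
have cuS : series u n.+1 @[n --> \oo] --> limn (series u).
  by rewrite (cvg_shiftS (series u)).
near=> N.
have -> : limn (series u) - F N
    = (limn (series u) - series u N.+1) - (F N - series u N.+1) by ring.
rewrite (le_lt_trans (ler_normB _ _)) // (splitr e) ltrD //.
  by near: N; move/cvgrPdist_lt: cuS; exact.
rewrite (le_lt_trans (approx N N (leqnn N))) // (le_lt_trans (ler_norm _)) //.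
rewrite -normrN -sub0r.
by near: N; move/cvgrPdist_lt: Cth; exact.
Unshelve. all: by end_near.
Qed.

(** * Heights of specialised values and of the generic point *)

Section WeilHeight.
Variable R : realType.

(** The fraction is reduced and of absolute value at least 1, so its height is [ln |A|], split here
    into denominator and archimedean parts. *)
Lemma weil_height_frac (A b : int) (D : nat) : 0 < b -> coprimez A b ->
  1 <= `|A%:~R / (b ^+ D)%:~R : rat| ->
  weil_height R (A%:~R / (b ^+ D)%:~R)
  = D%:R * ln b%:~R + ln `|ratr (A%:~R / (b ^+ D)%:~R)|.
Proof.
move=> b0 Ab; have bD0 : 0 < b ^+ D by rewrite exprn_gt0.
have AbD : coprime `|A| `|b ^+ D| by rewrite -coprimezE coprimezXr.
rewrite normf_div ler_pdivlMr ?normr_gt0 ?intr_eq0 ?gt_eqF // mul1r.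
rewrite -!intr_norm ler_int (gtr0_norm bD0) => bA.
rewrite /weil_height coprimeq_num // coprimeq_den // gt_eqF // gtr0_sg // mul1r.
rewrite (gtr0_norm bD0). rewrite max_l ?ler_int //.
have A0 : 0 < `|A| by exact: lt_le_trans bA.
have bR : 0 < b%:~R :> R by rewrite ltr0z.
rewrite fmorph_div /= !ratr_int normf_div -!intr_norm (gtr0_norm bD0).
rewrite rmorphXn /= ln_div ?posrE ?exprn_gt0 ?ltr0z // lnXn //.
by rewrite mulr_natl addrCA subrr addr0.
Qed.

End WeilHeight.

(** The iterates are polynomials in [t]: their only pole is at infinity, of order the degree, so the
    sum over places has a single term. *)
Lemma canon_height_gen_lim (R : realType) (P : {poly rat}) (l : R) : 0 <= l ->
  (fun N => (size (iter N f_gen P)).-1%:R / 2 ^+ N : R) @ \oo --> l ->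
  canon_height_gen R P = l%:E.
Proof.
move=> l0 Pl; rewrite /canon_height_gen.
have termE : (fun beta : option algC =>
    (limn (fun N : nat => (neg_ord beta (iter N f_gen P))%:~R / 2 ^+ N : R))%:E)
    = (fun beta => if beta \in [set None] then l%:E else 0%E).
  apply/funext => -[b|].
    rewrite memNset // [X in limn X](_ : _ = cst 0) ?lim_cst //.
    apply/funext => N /=; rewrite /neg_ord.
    case: ifP => _; first by rewrite mul0r.
    by rewrite /ord_P1 max_l ?mul0r // oppr_le0.
  rewrite mem_set //; congr (_ %:E); apply/cvg_lim => //.
  rewrite [X in X @ _](_ : _ = (fun N => (size (iter N f_gen P)).-1%:R / 2 ^+ N
    : R)) //.
  apply/funext => N; congr (_ / _); rewrite /neg_ord.
  case: eqP => [->|_]; first by rewrite size_poly0.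
  by rewrite /ord_P1 opprK max_r.
by rewrite termE -esum_mkcond esum_set1.
Qed.

(** A root [b] too close to 0 would make [b^-1] a parameter beyond the escape radius at which the
    orbit vanishes. *)
Lemma rev_orbit_root_ge (K : numFieldType) (P : {poly int}) (d N : nat) (b : K)
  :
  (0 < d)%N -> P \is monic -> size P = d.+1 ->
  root (map_poly intr (rev_orbit P d N)) b ->
  ~~ (`|b| < ((escape_radius P)%:~R)^-1).
Proof.
move=> d0 Pm sP rb; apply/negP => bP.
have b0 : b != 0.
  apply: contraTneq rb => ->; rewrite /root -[0](rmorph0 (intmul 1)).
  by rewrite horner_map rev_orbit0 // oner_neq0.
have P0 : 0 < (escape_radius P)%:~R :> K by rewrite -invr_gt0
  (le_lt_trans _ bP).
have := @norm_escape_orbit_ge K P b^-1 N Pm.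
rewrite sP ltnS => /(_ d0); rewrite (horner_rev_orbit d0 sP) ?invr_neq0 //
  invrK.
rewrite (eqP rb) mulr0 normr0 normfV => h.
have /h : (escape_radius P)%:~R <= `|b|^-1.
  by rewrite -[leLHS]invrK lef_pV2 ?posrE ?invr_gt0 ?normr_gt0 // ltW.
by rewrite lern0.
Qed.

(** Stated as a convergence rather than as a value of [limn], so that it can also be used after an
    index shift and a rescaling. *)
Lemma weil_height_asymptotic (R : realType) (P : {poly int}) (d : nat) :
  (0 < d)%N -> P \is monic -> size P = d.+1 ->
  exists a : nat -> rat, a 0%N = 0 /\ exists r : R, 0 < r /\
    (forall z : R, `|z| < r -> cvgn (series (fun n => ratr (a n) * z ^+ n))) /\
    forall t : rat, r^-1 < `|ratr t| ->
      (fun N => weil_height R (iter N (f_spec t) (map_poly intr P).[t]) / 2 ^+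
        N)
        @ \oo --> d%:R * weil_height R t + pseries_sum a (ratr t)^-1.
Proof.
move=> d0 Pm sP.
pose Q N : {poly rat} := map_poly intr (rev_orbit P d N).
pose m N := (d * 2 ^ N.+1).-1.
have Q0 N : (Q N).[0] = 1.
  by rewrite /Q -[0](rmorph0 (intmul 1)) horner_map rev_orbit0.
have QS N : Q N.+1 = Q N ^+ 2 + 'X^(m N) by rewrite /Q /= rmorphD !rmorphXn /=
  map_polyX.
have m_gt N : (N < m N)%N.
  by rewrite /m expnS; have := ltn_expl N (ltnSn 1); nia.
pose a := log_coef Q.
pose E : R := (escape_radius P)%:~R.
have E6 : 6 <= E.
  rewrite -[6]/((6 : int)%:~R) ler_int lerDl mulr_ge0 // sumr_ge0 //.
have E0 : 0 < E by lra.
pose QR N : {poly R} := map_poly intr (rev_orbit P d N).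
have QRE N : QR N = map_poly ratr (Q N).
  by apply/polyP => k; rewrite !coef_map /= ratr_int.
have r0 : 0 < E^-1 by rewrite invr_gt0.
pose u (z : R) n := ratr (a n) * z ^+ n.
(* The constant is free of [N]: the [d * 2 ^ N] in the root bound meets the division by [2 ^+ N]. *)
have approx z n N : `|z| < E^-1 -> (n <= N)%N ->
    `|ln `|(QR N).[z]| / 2 ^+ N - series (u z) n.+1|
      <= d%:R * `|z| / (E^-1 - `|z|) * (`|z| / E^-1) ^+ n.
  move=> zE nN.
  pose W : {poly R} := map_poly ratr (2 ^+ N *: \poly_(k < n.+1) a k).
  have Wd : W^`() = map_poly ratr ((2 ^+ N *: \poly_(k < n.+1) a k)^`()).
    by rewrite /W deriv_map.
  have Wz : W.[z] = 2 ^+ N * series (u z) n.+1.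
    rewrite /W (horner_coef_wide (n := n.+1)); last first.
      rewrite size_map_poly (leq_trans (size_scale_leq _ _)) // size_poly //.
    rewrite seriesEord /= mulr_sumr; apply: eq_bigr => i _.
    rewrite coef_map coefZ coef_poly ltn_ord /= rmorphM rmorphXn /= rmorph_nat.
    by rewrite /u /ratr !mulrA.
  have := @ln_horner_approx R (QR N) W n (d * 2 ^ N) E^-1 z r0.
  have QR0 : (QR N).[0] = 1.
    by rewrite QRE -[0](rmorph0 (@ratr R)) horner_map Q0 rmorph1.
  have sQ : (size (QR N) <= (d * 2 ^ N).+1)%N.
    by apply: leq_trans (size_poly _ _) (size_rev_orbit P d N).
  move=> /(_ QR0 sQ).
  have rootQ (b : R[i]) : root (map_poly (real_complex R) (QR N)) b ->
      (E^-1%:C)%C <= `|b|.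
    have -> : map_poly (real_complex R) (QR N) = map_poly intr
      (rev_orbit P d N).
      by apply/polyP => k; rewrite !coef_map /= rmorph_int.
    move=> /(rev_orbit_root_ge d0 Pm sP).
    rewrite -(rmorph_int (real_complex R)) -fmorphV normc_def ltcR lecR.
    by rewrite -leNgt.
  move=> /(_ rootQ).
  have W0 : W.[0] = 0 by rewrite horner_coef0 coef_map coefZ coef_poly /= mulr0
    rmorph0.
  have sW : (size W^`() <= n)%N.
    rewrite Wd size_map_poly derivZ (leq_trans (size_scale_leq _ _)) //.
    by rewrite (leq_trans (size_poly _ _)) // -subn1 leq_subLR add1n size_poly.
  have QW : log_deriv_mod n (QR N) W^`().
    rewrite /log_deriv_mod Wd QRE deriv_map -rmorphM -rmorphB.
    rewrite -(map_polyXn (@ratr R)) dvdp_map.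
    exact: (log_deriv_mod_log_coef Q0 QS m_gt nN).
  move=> /(_ W0 sW QW zE); rewrite Wz => h.
  have N2 : 0 < 2 ^+ N :> R by rewrite exprn_gt0.
  rewrite -(ler_pM2l N2) -{1}(gtr0_norm N2) -normrM mulrBr mulrCA divff ?gt_eqF
    // mulr1.
  rewrite (le_trans h) // natrM natrX le_eqVlt; apply/orP; left; apply/eqP.
  by ring.
have cvgu z : `|z| < E^-1 -> cvgn (series (u z)) /\
    (fun N => ln `|(QR N).[z]| / 2 ^+ N) @ \oo --> limn (series (u z)).
  move=> zE; apply: (@cvg_series_approx R _ _ _ (`|z| / E^-1)).
    by apply/andP; split; rewrite ?ltr_pdivrMr ?mul1r // divr_ge0 // ltW.
  by move=> n N nN; exact: approx.
exists a; split=> //; exists E^-1; split=> //; split; first by move=> z /cvgu[].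
move=> t; rewrite invrK => Et.
have tR : `|ratr t : R| = ratr `|t| by rewrite ratr_norm.
have Et' : (escape_radius P)%:~R <= `|t|.
  by rewrite -(ler_rat R) ratr_int -tR ltW.
have t6 : 1 < `|ratr t : R| by lra.
have tR0 : ratr t != 0 :> R by rewrite -normr_gt0; lra.
have t0 : t != 0 by move: tR0; rewrite fmorph_eq0.
set b := denq t; set n := numq t.
have b0 : 0 < b := denq_gt0 t.
have nb : coprimez n b by rewrite coprimezE coprime_num_den.
have tE : t = n%:~R / b%:~R by rewrite divq_num_den.
have htE : weil_height R t = ln b%:~R + ln `|ratr t|.
  have := @weil_height_frac R n b 1 b0 nb; rewrite expr1 -tE mul1r; apply.
  by rewrite -(ler_rat R) -tR rmorph1 ltW.
(* An exact identity for every [N]. With [D = d * 2 ^ N], the term [D ln b] from the denominator and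
   [D ln |t|] from the factor [t^D] combine into [D h(t)]. *)
have hN N : weil_height R (iter N (f_spec t) (map_poly intr P).[t]) / 2 ^+ N
   = d%:R * weil_height R t + ln `|(QR N).[(ratr t)^-1]| / 2 ^+ N.
  have x3 := @norm_escape_orbit_ge rat P t N Pm.
  rewrite sP ltnS in x3; move: (x3 d0 Et') => {}x3.
  have xE := @horner_rev_orbit P d d0 sP rat t N t0.
  have [|A cA xA] := @orbit_frac P d d0 Pm sP n b N _ nb; first by rewrite
    gt_eqF.
  rewrite -tE in xA.
  rewrite -[f_spec t]/(fun x => x ^+ 2 + t) xA weil_height_frac -?xA //; last
    first.
    by rewrite (le_trans _ x3) // ler1n.
  rewrite xE (rmorphM (@ratr R)) (rmorphXn (@ratr R)) -/(Q N) -horner_map -QRE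
    fmorphV.
  have Qn0 : (QR N).[(ratr t)^-1] != 0.
    rewrite QRE -fmorphV horner_map fmorph_eq0.
    apply: contraTneq x3 => Qt0; rewrite xE -/(Q N) Qt0 mulr0 normr0 lern0 //.
  rewrite normrM normrX lnM ?posrE ?exprn_gt0 ?normr_gt0 // lnXn ?normr_gt0 //
    htE.
  rewrite -[ln _ *+ _]mulr_natl natrM natrX.
  by field; rewrite expf_neq0.
have zE : `|(ratr t)^-1| < E^-1 :> R.
  by rewrite normfV ltf_pV2 ?posrE // normr_gt0.
rewrite (eq_cvg _ _ hN); apply: cvgD; first exact: cvg_cst.
exact: (cvgu _ zE).2.
Qed.

Lemma monic_iter_f_gen (P : {poly rat}) (d N : nat) : (0 < d)%N ->
  P \is monic -> size P = d.+1 ->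
  iter N f_gen P \is monic /\ size (iter N f_gen P) = (d * 2 ^ N).+1.
Proof.
move=> d0 Pm sP; elim: N => [|N [IHm IHs]] /=; first by rewrite muln1.
set q := iter _ _ _ in IHm IHs *; rewrite /f_gen.
have sq : size (q ^+ 2) = (d * 2 ^ N.+1).+1.
  by rewrite expr2 size_monicM ?monic_neq0 // IHs expnS; lia.
have lt : (size ('X : {poly rat}) < size (q ^+ 2)%R)%N.
  by rewrite sq size_polyX ltnS expnS; have := expn_gt0 2 N; nia.
rewrite size_polyDl // sq; split => //.
by rewrite monicE lead_coefDl // (monicP (monic_exp 2 IHm)).
Qed.

Lemma canon_height_gen_monic (R : realType) (P : {poly rat}) (d : nat) :
  (0 < d)%N -> P \is monic -> size P = d.+1 ->
  canon_height_gen R P = (d%:R)%:E.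
Proof.
move=> d0 Pm sP; apply: canon_height_gen_lim => //.
rewrite [X in X @ _](_ : _ = cst d%:R); first exact: cvg_cst.
apply/funext => N /=; have [_ ->] := monic_iter_f_gen N d0 Pm sP.
by rewrite natrM natrX mulfK // expf_neq0.
Qed.

Theorem theorem2 (R : realType) (P : {poly int}) :
  P \is monic ->
  exists a : nat -> rat,
    a 0%N = 0 /\
    exists r : R, 0 < r /\
      (forall z : R, `|z| < r ->
         cvgn (series (fun n => ratr (a n) * z ^+ n))) /\
      exists T : R, r^-1 <= T /\
        forall t : rat, T < `|ratr t| ->
          ((canon_height_spec R t (map_poly intr P : {poly rat}).[t])%:E =
           canon_height_gen R (map_poly intr P) * (weil_height R t)%:E
           + (pseries_sum a (ratr t)^-1)%:E)%E.
Proof.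
move=> Pm.
have PQm : (map_poly intr P : {poly rat}) \is monic by exact: monic_map.
have sPQ : size (map_poly intr P : {poly rat}) = size P.
  by rewrite size_map_inj_poly // => x y; exact: intr_inj.
case: (ltnP 1 (size P)) => sP.
  have d0 : (0 < (size P).-1)%N by lia.
  have sPd : size P = (size P).-1.+1 by lia.
  have [a [a0 [r [r0 [ca ha]]]]] := weil_height_asymptotic R d0 Pm sPd.
  exists a; split=> //; exists r; split=> //; split=> //; exists r^-1; split=>
    // t rt.
  rewrite (canon_height_gen_monic R d0 PQm) ?sPQ // -EFinM -EFinD; congr (_%:E).
  by apply/cvg_lim => //; exact: ha.
have P1 : P = 1.
  have := size1_polyC sP; move: Pm; rewrite monicE lead_coefE.
  have -> : (size P).-1 = 0%N by lia.
  by move=> /eqP ->.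
pose P' : {poly int} := 'X + 1.
have sP' : size P' = 2 by rewrite size_XaddC.
have P'm : P' \is monic by exact: monicXaddC.
have [a [a0 [r [r0 [ca ha]]]]] := weil_height_asymptotic R (ltnSn 0) P'm sP'.
exists (fun n => a n / 2); split; first by rewrite a0 mul0r.
exists r; split=> //.
have serE (z : R) : series (fun n => ratr (a n / 2) * z ^+ n)
    = 2^-1 *: series (fun n => ratr (a n) * z ^+ n).
  apply/funext => n; rewrite fctE /series /= scaler_sumr; apply: eq_bigr => i _.
  by rewrite fmorph_div /= rmorph_nat /GRing.scale /=; ring.
split=> [z zr|]; first by rewrite serE; apply: is_cvgZr; exact: ca.
exists r^-1; split=> // t rt.
have PE : map_poly intr P = 1 :> {poly rat} by rewrite P1 rmorph1.
have fE : f_gen 1 = map_poly intr P' by rewrite /f_gen expr1n rmorphD /=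
  map_polyX rmorph1 addrC.
rewrite PE hornerC.
(* The iterate of index [N + 1] has degree [2 ^ N], so the shifted sequence is constant. *)
have -> : canon_height_gen R 1 = (2^-1)%:E.
  apply: canon_height_gen_lim; first by rewrite invr_ge0.
  rewrite -(cvg_shiftS (fun N => (size (iter N f_gen 1)).-1%:R / 2 ^+ N : R)).
  rewrite [X in X @ _](_ : _ = cst 2^-1); first exact: cvg_cst.
  apply/funext => N /=; rewrite -iterS iterSr fE.
  have P'Qm : (map_poly intr P' : {poly rat}) \is monic by exact: monic_map.
  have sP'Q : size (map_poly intr P' : {poly rat}) = 2.
    by rewrite size_map_inj_poly // => x y; exact: intr_inj.
  have [_ ->] := monic_iter_f_gen N (ltnSn 0) P'Qm sP'Q.
  by rewrite /= mul1n natrX exprS invfM mulrCA divff ?mulr1 // expf_neq0.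
rewrite -EFinM -EFinD; congr (_%:E).
have rt' : `|(ratr t)^-1 : R| < r.
  by rewrite normfV -[r]invrK ltf_pV2 ?posrE ?invr_gt0 // (lt_trans _ rt) //
    invr_gt0.
have -> : pseries_sum (fun n => a n / 2) (ratr t)^-1
    = 2^-1 * pseries_sum a (ratr t)^-1 :> R.
  by rewrite /pseries_sum serE limZr //; exact: ca.
apply/cvg_lim => //.
rewrite -(cvg_shiftS (fun N => weil_height R (iter N (f_spec t) 1) / 2 ^+ N)).
rewrite -mulrDr -[weil_height R t]mul1r.
rewrite [X in X @ _](_ : _ = (fun N => 2^-1 *
    (weil_height R (iter N (f_spec t) (map_poly intr P').[t]) / 2 ^+ N))); last
      first.
  apply/funext => N /=; rewrite -iterS iterSr.
  have -> : f_spec t 1 = (map_poly intr P').[t].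
    by rewrite -fE /f_gen /f_spec !hornerE.
  by rewrite exprS invfM mulrCA.
apply: cvgMr; exact: ha.
Qed.
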